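(* Let $A$ be a finite abelian group. Then there exists a finite simple left brace $B$ such that $A$ is (isomorphic to) a subgroup of the additive group $(B,+)$, the multiplicative group $(B,\cdot)$ is metabelian, and all Sylow subgroups of $(B,\cdot)$ are abelian.
   Context: A left brace is a set $B$ with two binary operations $+$ and $\cdot$ such that $(B,+)$ is an abelian group, $(B,\cdot)$ is a group, and $a\cdot(b+c)+a=a\cdot b+a\cdot c$ for all $a,b,c\in B$. For $a,b\in B$ put $\lambda_a(b)=a\cdot b-a$; then $a\mapsto\lambda_a$ is a homomorphism $(B,\cdot)\to\operatorname{Aut}(B,+)$. An ideal of $B$ is a normal subgroup $I$ of $(B,\cdot)$ such that $\lambda_a(b)\in I$ for all $b\in I$ and $a\in B$. (The identity elements of $(B,+)$ and $(B,\cdot)$ coincide and are denoted $0$.) A left brace $B$ is simple if $B\neq\{0\}$ and $\{0\}$ and $B$ are the only ideals of $B$. A group is metabelian if its commutator subgroup is abelian. *)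

(* Defs.v *)
From HB Require Import structures.
From mathcomp Require Import all_boot all_fingroup all_solvable all_algebra.

Set Implicit Arguments.
Unset Strict Implicit.
Unset Printing Implicit Defensive.

Import GRing.Theory.
Local Open Scope ring_scope.

(* Both operations live on the same carrier: the abelian group (B, +) is the
   zmodType structure (ring_scope), and the group (B, .) is the groupType
   structure (group_scope). *)
HB.mixin Record Zmodule_Group_isLeftBrace B of GRing.Zmodule B & monoid.Group B := {
  brace_distr : forall a b c : B, (a * (b + c)%R)%g + a = (a * b)%g + (a * c)%g
}.

#[short(type="leftBraceType")]
HB.structure Definition LeftBrace :=
  {B of Zmodule_Group_isLeftBrace B & GRing.Zmodule B & monoid.Group B}.

(* As in MathComp, group-theoretic notions on a finLeftBraceType (such as
   {group B}, 'Syl_p(G), <|, abelian) refer to the finGroupType structure,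
   hence to the multiplicative group (B, .). *)
#[short(type="finLeftBraceType")]
HB.structure Definition FinLeftBrace :=
  {B of LeftBrace B & FinGroup B}.

Section LeftBraceTheory.
Variable B : leftBraceType.
Implicit Types a b c : B.

Definition lambda a b : B := (a * b)%g - a.

Lemma brace_one0 : 1%g = 0 :> B.
Proof.
have := brace_distr (1%g : B) 0 0.
by rewrite addr0 mul1g => /addrI.
Qed.

Lemma lambdaD a : {morph lambda a : b c / b + c}.
Proof.
move=> b c; rewrite /lambda addrACA -brace_distr.
by rewrite [RHS]addrA addrK.
Qed.

Lemma lambdaM a b c : lambda (a * b)%g c = lambda a (lambda b c).
Proof.
have lB d e : lambda a (d - e) = lambda a d - lambda a e.
  by apply: (addIr (lambda a e)); rewrite -lambdaD !subrK.
by rewrite [lambda b c]/lambda lB /lambda opprB addrA subrK mulgA.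
Qed.

End LeftBraceTheory.

Definition brace_ideal (B : finLeftBraceType) (I : {group B}) : Prop :=
  (I <| [set: B])%g /\ (forall a b : B, b \in I -> lambda a b \in I).

Definition simple_left_brace (B : finLeftBraceType) : Prop :=
  [set: B] <> [set 0] /\
  (forall I : {group B}, brace_ideal I -> I :=: [set 0] \/ I :=: [set: B]).

Definition metabelian (gT : finGroupType) (G : {set gT}) : bool :=
  abelian [~: G, G]%g.

(* Main.v *)
(* For coprime finite commutative rings R1 and R2, let T1 be the zero-sum
   functions R1 -> R2 and T2 the zero-sum functions R2 -> R1; each R_i acts on
   T_i by translation and preserves the form b(f, g) = \sum_x f x * g x, with
   values in the other ring.  On B = (T1 x T2) x (R1 x R2) take the semidirect
   product as multiplication and the extension with cocycle b as addition.
   As |R1| is invertible in R2 and conversely, b is nondegenerate, T_i is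
   spanned by the differences s.f - f, and for each s <> 0 the values
   b(s.f - f, g) exhaust the ring.  An ideal containing (t, s) contains all
   (0, b(t, u)) and (s.u - u, 0), so a nonzero ideal contains some nonzero s,
   say in R1, hence R2, hence R1, hence everything.  Multiplicatively B is the
   product of the T_i x| R_i, in which |T_i| and |R_i| are coprime, so that a
   Sylow subgroup of each factor lies in T_i or in a conjugate of R_i.  Finally
   A embeds in its trivial extension by Z/2|A|, which serves as R1, and
   Z/(|R1| + 1) serves as R2. *)
From HB Require Import structures.
Require Import Defs.
From mathcomp Require Import all_boot all_fingroup all_solvable all_algebra.

Set Implicit Arguments.
Unset Strict Implicit.
Unset Printing Implicit Defensive.

Import GRing.Theory.
Local Open Scope ring_scope.

(** * Asymmetric product of two trivial braces *)

Record asym_datum (T S : finZmodType) := AsymDatum {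
  asym_act : S -> T -> T;
  asym_form : T -> T -> S;
  asym_actD : forall s, {morph asym_act s : t u / t + u};
  asym_act0 : asym_act 0 =1 id;
  asym_actDs : forall s s' t, asym_act (s + s') t = asym_act s (asym_act s' t);
  asym_formC : commutative asym_form;
  asym_formDl : forall u, {morph asym_form^~ u : t t' / t + t'};
  asym_form_act : forall s t u,
    asym_form (asym_act s t) (asym_act s u) = asym_form t u }.

(* The asymmetric product of two trivial braces: additively an extension of T
   by S with cocycle the form, multiplicatively a semidirect product. *)
Definition asym (T S : finZmodType) of asym_datum T S : Type := (T * S)%type.

Section AsymmetricProduct.
Variables (T S : finZmodType) (D : asym_datum T S).
Local Notation B := (asym D).
Local Notation act := (asym_act D).
Local Notation form := (asym_form D).
Implicit Types (t u : T) (s : S) (x y z : B).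

Lemma asym_formDr t : {morph form t : u u' / u + u'}.
Proof. by move=> u u'; rewrite !(asym_formC _ t) asym_formDl. Qed.

Lemma asym_form0r t : form t 0 = 0.
Proof. by apply: (addIr (form t 0)); rewrite -asym_formDr !add0r. Qed.

Lemma asym_form0l t : form 0 t = 0.
Proof. by rewrite asym_formC asym_form0r. Qed.

Lemma asym_formNr t u : form t (- u) = - form t u.
Proof.
by apply: (addIr (form t u)); rewrite -asym_formDr !addNr asym_form0r.
Qed.

Lemma asym_act0r s : act s 0 = 0.
Proof. by apply: (addIr (act s 0)); rewrite -asym_actD !add0r. Qed.

Lemma asym_actN s t : act s (- t) = - act s t.
Proof. by apply: (addIr (act s t)); rewrite -asym_actD !addNr asym_act0r. Qed.

HB.instance Definition _ := Finite.copy B (T * S)%type.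

Definition asym_add x y : B := (x.1 + y.1, x.2 + y.2 + form x.1 y.1).
(** The cocycle at [x.1] and [- x.1] is [- form x.1 x.1], which the extra term cancels. *)
Definition asym_opp x : B := (- x.1, - x.2 + form x.1 x.1).
Definition asym_zero : B := (0, 0).

Fact asym_addA : associative asym_add.
Proof.
move=> x y z; rewrite /asym_add /= addrA asym_formDl asym_formDr; congr (_, _).
by rewrite !addrA [LHS](ACl (1*2*5*3*6*4))%AC.
Qed.

Fact asym_addC : commutative asym_add.
Proof.
by move=> x y; rewrite /asym_add (addrC y.1) (addrC y.2) asym_formC.
Qed.

Fact asym_add0 : left_id asym_zero asym_add.
Proof. by case=> t s; rewrite /asym_add /= asym_form0l !add0r addr0. Qed.

Fact asym_addN : left_inverse asym_zero asym_opp asym_add.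
Proof.
move=> [t s]; rewrite /asym_add /asym_opp /= addNr asym_formC asym_formNr.
by rewrite addrAC addrK addNr.
Qed.

HB.instance Definition _ :=
  GRing.isZmodule.Build B asym_addA asym_addC asym_add0 asym_addN.

Definition asym_mul x y : B := (x.1 + act x.2 y.1, x.2 + y.2).
Definition asym_inv x : B := (- act (- x.2) x.1, - x.2).

Fact asym_mulA : associative asym_mul.
Proof.
by move=> x y z; rewrite /asym_mul /= asym_actD asym_actDs !addrA.
Qed.

Fact asym_mul1 : left_id asym_zero asym_mul.
Proof. by case=> t s; rewrite /asym_mul /= asym_act0 !add0r. Qed.

Fact asym_mulV : left_inverse asym_zero asym_inv asym_mul.
Proof. by move=> [t s]; rewrite /asym_mul /asym_inv /= !addNr. Qed.

HB.instance Definition _ :=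
  Finite_isGroup.Build B asym_mulA asym_mul1 asym_mulV.

Lemma asym_addE x y : x + y = (x.1 + y.1, x.2 + y.2 + form x.1 y.1) :> B.
Proof. by []. Qed.

Lemma asym_oppE x : - x = (- x.1, - x.2 + form x.1 x.1) :> B.
Proof. by []. Qed.

Lemma asym_mulE x y : (x * y)%g = (x.1 + act x.2 y.1, x.2 + y.2) :> B.
Proof. by []. Qed.

Lemma asym_invE x : (x^-1)%g = (- act (- x.2) x.1, - x.2) :> B.
Proof. by []. Qed.

(** After bilinear expansion the two sides differ only by [form y.1 z.1] against its value on the
    images under [act x.2]; invariance of the form identifies these. *)
Fact asym_distr (x y z : B) : (x * (y + z)%R)%g + x = (x * y)%g + (x * z)%g.
Proof.
rewrite !asym_mulE !asym_addE /= asym_actD; congr (_, _).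
  by rewrite addrAC addrACA addrA.
rewrite !(asym_formDl, asym_formDr) asym_form_act.
rewrite (asym_formC _ (act _ z.1) x.1).
set a := form y.1 z.1; set b := form x.1 x.1.
set c := form (act x.2 y.1) x.1; set d := form x.1 _.
by rewrite !addrA [LHS](ACl (1*2*5*3*6*8*7*4))%AC.
Qed.

HB.instance Definition _ := Zmodule_Group_isLeftBrace.Build B asym_distr.

Lemma asym_lambdaE x y :
  lambda x y = (act x.2 y.1, y.2 - form (act x.2 y.1) x.1).
Proof.
rewrite /lambda asym_mulE asym_oppE asym_addE /=; congr (_, _).
  by rewrite addrAC subrr add0r.
rewrite asym_formNr asym_formDl opprD addrA.
by rewrite !addrA [LHS](ACl ((1*3)*2*(4*5)*6))%AC /= !subrr add0r addr0.
Qed.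

(** * Elements forced into an ideal *)

Section Ideal.
Variables (I : {group B}) (idealI : brace_ideal I).

(** [lambda (- u, 0)] changes [x] only by adding [form x.1 u] to its second coordinate; multiplying
    by [x^-1] on the left isolates the change. *)
Lemma asym_ideal_form x u : x \in I -> ((0, form x.1 u) : B) \in I.
Proof.
move=> Ix; have /(_ (- u, 0)) := idealI.2 _ x; move=> /(_ Ix).
rewrite asym_lambdaE /= asym_act0 asym_formNr opprK => Iy.
suff -> : ((0, form x.1 u) : B) = (x^-1 * ((x.1, x.2 + form x.1 u) : B))%g.
  by rewrite groupM ?groupV.
by rewrite asym_mulE asym_invE /= addNr addKr.
Qed.

(** This element is the multiplicative commutator of [x] and [(u, 0)], so normality of [I]
    suffices. *)
Lemma asym_ideal_act x u : x \in I -> ((act x.2 u - u, 0) : B) \in I.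
Proof.
move=> Ix; pose y : B := (u, 0).
have nIy : (y * x^-1 * y^-1)%g \in I.
  have -> : (y * x^-1 * y^-1 = x^-1 ^ (y^-1))%g by rewrite conjgE invgK mulgA.
  rewrite memJ_norm ?groupV //.
  by case: idealI => /andP[_ /subsetP nI] _; apply: nI; rewrite inE.
suff -> : ((act x.2 u - u, 0) : B) = (x * (y * x^-1 * y^-1))%g.
  by rewrite groupM.
rewrite !asym_mulE !asym_invE /= !(asym_act0, oppr0, addr0, add0r).
rewrite subrr !asym_actD asym_actN -!asym_actDs subrr !asym_act0.
by rewrite addrA addrCA subrr addr0.
Qed.

Lemma asym_ideal_addS s s' :
  ((0, s) : B) \in I -> ((0, s') : B) \in I -> ((0, s + s') : B) \in I.
Proof. by move=> Is /(groupM Is); rewrite asym_mulE /= asym_act0r addr0. Qed.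

Lemma asym_ideal_addT t t' :
  ((t, 0) : B) \in I -> ((t', 0) : B) \in I -> ((t + t', 0) : B) \in I.
Proof. by move=> It /(groupM It); rewrite asym_mulE /= asym_act0 addr0. Qed.

Lemma asym_ideal_pair t s :
  ((t, 0) : B) \in I -> ((0, s) : B) \in I -> ((t, s) : B) \in I.
Proof.
by move=> It /(groupM It); rewrite asym_mulE /= asym_act0 addr0 add0r.
Qed.

End Ideal.

(** The elements with zero second coordinate form an abelian subgroup, which contains all
    commutators because [S] is commutative. *)
Lemma asym_metabelian : metabelian [set: B].
Proof.
pose K := [set x : B | x.2 == 0].
have gK : group_set K.
  apply/group_setP; split=> [|x y]; rewrite !inE ?eqxx //.
  by move=> /eqP x0 /eqP y0; rewrite asym_mulE /= x0 y0 addr0.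
have sK : ([~: [set: B], [set: B]] \subset Group gK)%g.
  rewrite gen_subG; apply/subsetP=> _ /imset2P[x y _ _ ->]; rewrite inE.
  rewrite /commg /conjg !asym_mulE !asym_invE /=.
  by rewrite (addrC x.2) addKr addNr.
apply: abelianS sK _; apply/centsP=> x; rewrite inE => /eqP x0 y.
rewrite inE => /eqP y0; rewrite /commute !asym_mulE x0 y0 !asym_act0.
by rewrite addrC.
Qed.

Lemma asym_exp_snd x n : ((x ^+ n)%g : B).2 = x.2 *+ n.
Proof. by elim: n => //= n IHn; rewrite expgS asym_mulE /= IHn mulrS. Qed.

Lemma asym_exp_fst t n : (((t, 0) : B) ^+ n)%g = (t *+ n, 0).
Proof.
elim: n => //= n IHn; rewrite expgS asym_mulE /= IHn mulrS asym_act0.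
by rewrite addr0.
Qed.

Definition asym_inr s : B := (0, s).

Fact asym_inr_zmod_morphism : zmod_morphism asym_inr.
Proof.
move=> s s'; rewrite asym_oppE asym_addE /= !asym_form0l !addr0.
by rewrite oppr0 addr0.
Qed.

HB.instance Definition _ :=
  GRing.isZmodMorphism.Build S B asym_inr asym_inr_zmod_morphism.

End AsymmetricProduct.

(** * Zero-sum functions, translations and the invariant form *)

Section ZeroSum.
Variables (G : finZmodType) (R : finComNzRingType).

Definition zero_sum : {pred {ffun G -> R}} :=
  [pred f : {ffun G -> R} | \sum_x f x == 0].

Fact zero_sum_zmod_closed : zmod_closed zero_sum.
Proof.
split=> [|f g]; rewrite !inE; first by rewrite big1 // => x _; rewrite ffunE.
move=> /eqP f0 /eqP g0; under eq_bigr do rewrite !ffunE.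
by rewrite big_split sumrN /= f0 g0 subrr.
Qed.

HB.instance Definition _ :=
  GRing.isZmodClosed.Build {ffun G -> R} zero_sum zero_sum_zmod_closed.

Record zsfun :=
  ZSFun { zsfun_val :> {ffun G -> R}; _ : zsfun_val \in zero_sum }.

HB.instance Definition _ := [isSub for zsfun_val].
HB.instance Definition _ := [Finite of zsfun by <:].
HB.instance Definition _ := [SubChoice_isSubZmodule of zsfun by <:].

Implicit Types (f g : zsfun) (a : G).

Lemma zsfun_sum0 f : \sum_x f x = 0.
Proof. by apply/eqP; have := valP f; rewrite inE. Qed.

Lemma zsfunP f g : f =1 g -> f = g.
Proof. by move=> fg; apply/val_inj/ffunP. Qed.

Lemma zsfunD f g x : (f + g) x = f x + g x. Proof. by rewrite ffunE. Qed.
Lemma zsfunN f x : (- f) x = - f x. Proof. by rewrite ffunE. Qed.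
Lemma zsfun0 x : (0 : zsfun) x = 0. Proof. by rewrite ffunE. Qed.

Lemma zsfunMn f n x : (f *+ n) x = f x *+ n.
Proof. by elim: n => [|n IHn]; rewrite ?zsfun0 // !mulrS zsfunD IHn. Qed.

Lemma zsfun_sumE I (r : seq I) (F : I -> zsfun) x :
  (\sum_(i <- r) F i) x = \sum_(i <- r) F i x.
Proof.
by elim: r => [|i r IHr]; rewrite ?big_nil ?zsfun0 // !big_cons zsfunD IHr.
Qed.

Fact zstrans_subproof a f : [ffun x => f (x + a)] \in zero_sum.
Proof.
rewrite inE; under eq_bigr do rewrite ffunE.
rewrite (reindex_inj (addIr (- a))) /=; apply/eqP.
by rewrite -[RHS](zsfun_sum0 f); apply: eq_bigr => x _; rewrite subrK.
Qed.
Definition zstrans a f := ZSFun (zstrans_subproof a f).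

Lemma zstransE a f x : zstrans a f x = f (x + a). Proof. by rewrite ffunE. Qed.

Lemma zstransD a : {morph zstrans a : f g / f + g}.
Proof. by move=> f g; apply: zsfunP => x; rewrite !(zsfunD, zstransE). Qed.

Lemma zstrans0 : zstrans 0 =1 id.
Proof. by move=> f; apply: zsfunP => x; rewrite zstransE addr0. Qed.

Lemma zstransDs a b f : zstrans (a + b) f = zstrans a (zstrans b f).
Proof. by apply: zsfunP => x; rewrite !zstransE addrA. Qed.

Definition zsform f g := \sum_x f x * g x.

Lemma zsformC : commutative zsform.
Proof. by move=> f g; apply: eq_bigr => x _; rewrite mulrC. Qed.

Lemma zsformDl g : {morph zsform^~ g : f f' / f + f'}.
Proof.
move=> f f'; rewrite -big_split; apply: eq_bigr => x _.
by rewrite zsfunD mulrDl.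
Qed.

Lemma zsform0l f : zsform 0 f = 0.
Proof. by rewrite /zsform big1 // => x _; rewrite zsfun0 mul0r. Qed.

Lemma zsform_trans a f g : zsform (zstrans a f) (zstrans a g) = zsform f g.
Proof.
rewrite /zsform (reindex_inj (addIr (- a))) /=.
by apply: eq_bigr => x _; rewrite !zstransE subrK.
Qed.

Variable k : nat.
Hypothesis kG : (k * #|G|)%:R = 1 :> R.

(** Since [k] inverts [#|G|] in [R], the subtracted constant is the mean of [f]. *)
Fact zsproj_subproof (f : {ffun G -> R}) :
  [ffun x => f x - k%:R * \sum_y f y] \in zero_sum.
Proof.
rewrite inE; under eq_bigr do rewrite ffunE.
rewrite big_split sumrN /= sumr_const -mulrnAl -mulr_natr -natrM.
by rewrite kG mul1r subrr.
Qed.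
Definition zsproj (f : {ffun G -> R}) := ZSFun (zsproj_subproof f).

(** Zero-sum functions are orthogonal to constants, so the subtracted mean does not contribute. *)
Lemma zsform_proj f (h : {ffun G -> R}) :
  zsform f (zsproj h) = \sum_x f x * h x.
Proof.
rewrite /zsform; under eq_bigr do rewrite ffunE mulrBr.
by rewrite big_split sumrN /= -mulr_suml zsfun_sum0 mul0r subr0.
Qed.

Definition zsdelta a r := zsproj [ffun x => r *+ (x == a)].

Lemma zsform_delta f a r : zsform f (zsdelta a r) = f a * r.
Proof.
rewrite zsform_proj (bigD1 a) //= ffunE eqxx mulr1n big1 ?addr0 // => x.
by move=> /negPf xa; rewrite ffunE xa mulr0.
Qed.

Lemma zsform_nondegenerate f : f != 0 -> exists g, zsform f g != 0.
Proof.
move=> f0; have [/forallP f00|/forallPn[a fa0]] := boolP [forall a, f a == 0].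
  by case/eqP: f0; apply: zsfunP => x; rewrite zsfun0; apply/eqP.
by exists (zsdelta a 1); rewrite zsform_delta mulr1.
Qed.

Lemma zsform_trans_sub_onto a r :
  a != 0 -> exists f g, zsform (zstrans a f - f) g = r.
Proof.
(* Pairing with [zsdelta (- a) r] multiplies the value at [- a] by [r]. That value is
   [f 0 - f (- a)], equal to 1 for the projected point mass [f] at 0: the means cancel and [- a] is
   not 0. *)
move=> a0; exists (zsdelta 0 1), (zsdelta (- a) r).
rewrite zsform_delta zsfunD zsfunN zstransE !ffunE addNr eqxx oppr_eq0.
by rewrite (negPf a0) opprB addrA subrK subr0 mul1r.
Qed.

Lemma zsfun_trans_span (K : {pred zsfun}) :
    0 \in K -> {in K &, forall f g, f + g \in K} ->
    (forall a f, zstrans a f - f \in K) ->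
  forall f, f \in K.
Proof.
move=> K0 KD Ktrans f.
(* The translates of [- f] sum to zero, leaving [#|G|] copies of [f], a factor that [k] inverts. The
   sign sits inside because [K] is only assumed closed under addition. *)
suff -> : f = (\sum_a (zstrans a (- f) - - f)) *+ k.
  suff: \sum_a (zstrans a (- f) - - f) \in K.
    by move: (\sum_a _) => g Kg; elim: k => // n IHn; rewrite mulrS KD.
  by elim/big_ind: _ => // g g'; apply: KD.
apply: zsfunP => x; rewrite zsfunMn zsfun_sumE.
under eq_bigr do rewrite zsfunD zstransE opprK zsfunN.
rewrite big_split sumrN /= (reindex_inj (addrI (- x))) /=.
under eq_bigr do rewrite addrA subrr add0r.
by rewrite zsfun_sum0 oppr0 add0r sumr_const -mulrnA mulnC -mulr_natr kG mulr1.
Qed.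

End ZeroSum.

(* Declares the missing join: a product of two finZmodTypes is a finZmodType. *)
HB.saturate prod.

(** * Torsion and inverses under coprimality *)

Lemma mulrn_card (V : finZmodType) (v : V) : v *+ #|V| = 0.
Proof. by rewrite -FinRing.zmodXgE -cardsT expg_cardG ?inE. Qed.

Lemma coprime_mulrn_eq0 (V : finZmodType) (v : V) n :
  coprime n #|V| -> v *+ n = 0 -> v = 0.
Proof.
move=> co_nV vn0; have V_gt0 : (0 < #|V|)%N by apply/card_gt0P; exists v.
have [a b ab _] := egcdnP n V_gt0.
move: ab; rewrite gcdnC (eqP co_nV) => /(congr1 (GRing.natmul v)).
by rewrite mulnC mulrnA mulrn_card mul0rn mulrnDr mulnC mulrnA vn0 mul0rn add0r.
Qed.

Lemma coprime_natr_inv (R : finComNzRingType) n :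
  coprime n #|R| -> exists k, (k * n)%:R = 1 :> R.
Proof.
case: (posnP n) => [->|n_gt0 co_nR].
  rewrite /coprime gcd0n => /eqP R1; have /eqP := mulrn_card (1 : R).
  by rewrite R1 oner_eq0.
have [a b ab _] := egcdnP #|R| n_gt0; exists a.
by rewrite ab (eqP co_nR) natrD mulrnA mulrn_card add0r.
Qed.

Lemma zsfun_mulrn_eq0 (G : finZmodType) (R : finComNzRingType)
    (f : zsfun G R) n :
  coprime n #|R| -> f *+ n = 0 -> f = 0.
Proof.
move=> co_nR fn0; apply: zsfunP => x; rewrite zsfun0.
by apply: coprime_mulrn_eq0 co_nR _; rewrite -zsfunMn fn0 zsfun0.
Qed.

(** * The simple brace of two coprime rings *)

Section Construction.
Variables (R1 R2 : finComNzRingType).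
Hypothesis coR : coprime #|R1| #|R2|.

Local Notation T := (zsfun R1 R2 * zsfun R2 R1)%type.
Local Notation S := (R1 * R2)%type.

Definition zsbrace_act (s : S) (t : T) : T :=
  (zstrans s.1 t.1, zstrans s.2 t.2).
Definition zsbrace_form (t u : T) : S := (zsform t.2 u.2, zsform t.1 u.1).

Fact zsbrace_actD s : {morph zsbrace_act s : t u / t + u}.
Proof. by move=> t u; rewrite /zsbrace_act !zstransD. Qed.

Fact zsbrace_act0 : zsbrace_act 0 =1 id.
Proof. by case=> f g; rewrite /zsbrace_act !zstrans0. Qed.

Fact zsbrace_actDs s s' t :
  zsbrace_act (s + s') t = zsbrace_act s (zsbrace_act s' t).
Proof. by rewrite /zsbrace_act !zstransDs. Qed.

Fact zsbrace_formC : commutative zsbrace_form.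
Proof. by move=> t u; rewrite /zsbrace_form zsformC (zsformC t.1). Qed.

Fact zsbrace_formDl u : {morph zsbrace_form^~ u : t t' / t + t'}.
Proof. by move=> t t'; rewrite /zsbrace_form !zsformDl. Qed.

Fact zsbrace_form_act s t u :
  zsbrace_form (zsbrace_act s t) (zsbrace_act s u) = zsbrace_form t u.
Proof. by rewrite /zsbrace_form !zsform_trans. Qed.

Definition zsbrace_datum := @AsymDatum T S _ _ zsbrace_actD zsbrace_act0
  zsbrace_actDs zsbrace_formC zsbrace_formDl zsbrace_form_act.
Local Notation zsbrace := (asym zsbrace_datum).

Implicit Types (s : S) (t u : T).
Let pt t s : zsbrace := (t, s).

Lemma zsbrace_simple : simple_left_brace zsbrace.
Proof.
have [k1 k1P] := coprime_natr_inv coR.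
have [k2 k2P] : exists k, (k * #|R2|)%:R = 1 :> R1.
  by apply: coprime_natr_inv; rewrite coprime_sym.
split.
  move/setP/(_ (pt 0 1)); rewrite !inE => /esym/eqP [/eqP].
  by rewrite oner_eq0.
move=> I idealI; have [/subsetP I0|] := boolP (I \subset [set 0]).
  left; apply/setP=> x; apply/idP/idP => [/I0 //|]; rewrite inE => /eqP->.
  exact: group1.
case/subsetPn=> -[t s] Ix; rewrite inE => x0; right; apply/setP=> y.
rewrite inE.
(* A nonzero [R1]-component yields all of [R2]: take the commutator with [(f, 0)], then pair it with
   [(g, 0)]. [onto2] is the mirror image. *)
have onto1 s' r : pt 0 s' \in I -> s'.1 != 0 -> pt 0 (0, r) \in I.
  move=> Is /(zsform_trans_sub_onto k1P r)[f [g fg]].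
  have := asym_ideal_form idealI (g, 0) (asym_ideal_act idealI (f, 0) Is).
  rewrite /= /zsbrace_form /= fg.
  by rewrite [X in (X, r)](_ : _ = 0) // zsformC zsform0l.
have onto2 s' r : pt 0 s' \in I -> s'.2 != 0 -> pt 0 (r, 0) \in I.
  move=> Is /(zsform_trans_sub_onto k2P r)[f [g fg]].
  have := asym_ideal_form idealI (0, g) (asym_ideal_act idealI (0, f) Is).
  rewrite /= /zsbrace_form /= fg.
  by rewrite [X in (r, X)](_ : _ = 0) // zsformC zsform0l.
have [s1 Is1 s1_neq0] : exists2 s', pt 0 s' \in I & s' != 0.
  have [t0|t_neq0] := eqVneq t 0.
    exists s; first by rewrite /pt -t0.
    by apply: contra x0 => /eqP->; rewrite t0.
  have [f0|/(zsform_nondegenerate k1P)[g fg]] := eqVneq t.1 0.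
    have [g0|/(zsform_nondegenerate k2P)[g fg]] := eqVneq t.2 0.
      by case/eqP: t_neq0; rewrite [t]surjective_pairing f0 g0.
    exists (zsbrace_form t (0, g)); first exact: asym_ideal_form Ix.
    by apply: contra fg => /eqP[->].
  exists (zsbrace_form t (g, 0)); first exact: asym_ideal_form Ix.
  by apply: contra fg => /eqP[_ ->].
(* Whichever component of [s1] is nonzero fills the other ring; the unit of that ring then fills the
   first one. *)
have [all1 all2] :
    (forall r, pt 0 (r, 0) \in I) /\ (forall r, pt 0 (0, r) \in I).
  have [a0|a_neq0] := eqVneq s1.1 0; last first.
    have all2 r := onto1 _ r Is1 a_neq0; split=> // r.
    exact: (onto2 (0, 1)) (oner_neq0 _).
  have [b0|b_neq0] := eqVneq s1.2 0.
    by case/eqP: s1_neq0; rewrite [s1]surjective_pairing a0 b0.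
  have all1 r := onto2 _ r Is1 b_neq0; split=> // r.
  exact: (onto1 (1, 0)) (oner_neq0 _).
have allS s' : pt 0 s' \in I.
  have -> : s' = (s'.1, 0) + (0, s'.2).
    by case: s' => r1 r2; congr (_, _); rewrite /= ?addr0 ?add0r.
  exact: asym_ideal_addS (all1 _) (all2 _).
have all_fst f : pt (f, 0) 0 \in I.
  apply: (zsfun_trans_span k1P (K := [pred f | pt (f, 0) 0 \in I])) => //=.
  - by rewrite inE group1.
  - move=> f1 f2; rewrite !inE => If1 If2.
    by rewrite -[X in pt (_, X)]addr0; apply: asym_ideal_addT If1 If2.
  move=> a h.
  (* Writing the zero component as [zstrans 0 0 - 0] exhibits the pair as [act s u - u] with
     [s = (a, 0)] and [u = (h, 0)]. *)
  rewrite inE -[X in pt (_, X)](subrr 0) -[X in pt (_, X - _)]zstrans0.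
  by have := asym_ideal_act idealI (h, 0) (allS (a, 0)).
have all_snd g : pt (0, g) 0 \in I.
  apply: (zsfun_trans_span k2P (K := [pred g | pt (0, g) 0 \in I])) => //=.
  - by rewrite inE group1.
  - move=> f1 f2; rewrite !inE => If1 If2.
    by rewrite -[X in pt (X, _)]addr0; apply: asym_ideal_addT If1 If2.
  move=> a h.
  rewrite inE -[X in pt (X, _)](subrr 0) -[X in pt (X - _, _)]zstrans0.
  by have := asym_ideal_act idealI (0, h) (allS (0, a)).
case: y => -[f g] s'; apply: asym_ideal_pair (allS s').
rewrite -[f]addr0 -[g]add0r; exact: asym_ideal_addT (all_fst f) (all_snd g).
Qed.

(** Commutators in [P] lie in [T] and are killed by [#|P|], which is coprime to one of the two
    rings. Elements of [P] have zero component in that ring, hence fix the functions on it;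
    functions with values in it have no nonzero element killed by [#|P|]. *)
Lemma zsbrace_sylow_abelian p (P : {group zsbrace}) :
  prime p -> (p.-group P)%g -> abelian P.
Proof.
move=> p_pr pP.
have snd0 x : x \in P -> x.2 *+ #|P| = 0.
  by move=> Px; rewrite -asym_exp_snd expg_cardG.
have comm_fst x y : x \in P -> y \in P ->
    (zsbrace_act x.2 y.1 + x.1 - (zsbrace_act y.2 x.1 + y.1)) *+ #|P| = 0.
  move=> Px Py; set t := _ - _.
  have Pz : pt t 0 \in P.
    suff -> : pt t 0 = (x * y * (y * x)^-1)%g by rewrite !(groupM, groupV).
    apply: (canRL (mulgK _)).
    rewrite !asym_mulE /= zsbrace_act0 /t; congr (_, _).
      by rewrite (addrC y.1) subrK addrC.
    by rewrite add0r addrC.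
  by have [] : pt (t *+ #|P|) 0 = 0 by rewrite -[LHS]asym_exp_fst expg_cardG.
have co : coprime #|P| #|R1| \/ coprime #|P| #|R2|.
  have [e ->] := p_natP pP; case: (boolP (p %| #|R1|)%N) => p_R1; last first.
    by left; rewrite coprimeXl // prime_coprime.
  right; rewrite coprimeXl // prime_coprime //; apply/negP=> p_R2.
  have := dvdn_gcd p #|R1| #|R2|; rewrite (eqP coR) p_R1 p_R2 dvdn1.
  by move/eqP=> p1; rewrite p1 in p_pr.
apply/centsP=> x Px y Py; rewrite /commute !asym_mulE.
rewrite [y.2 + _]addrC; congr (_, _).
rewrite addrC [RHS]addrC; apply/eqP; rewrite -subr_eq0.
have /[dup] := comm_fst x y Px Py; set d := _ - _.
move=> /(congr1 fst); rewrite raddfMn => d1 /(congr1 snd).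
rewrite raddfMn => d2.
have := snd0 x Px; have := snd0 y Py.
move=> /[dup] /(congr1 fst); rewrite raddfMn => y1 /(congr1 snd).
rewrite raddfMn => y2.
move=> /[dup] /(congr1 fst); rewrite raddfMn => x1 /(congr1 snd).
rewrite raddfMn => x2.
apply/eqP/injective_projections; case: co => coP.
- rewrite /d /= (coprime_mulrn_eq0 coP x1) (coprime_mulrn_eq0 coP y1) !zstrans0.
  by rewrite (addrC x.1.1) subrr.
- exact: zsfun_mulrn_eq0 coP d1.
- exact: zsfun_mulrn_eq0 coP d2.
- rewrite /d /= (coprime_mulrn_eq0 coP x2) (coprime_mulrn_eq0 coP y2) !zstrans0.
  by rewrite (addrC x.1.2) subrr.
Qed.

Lemma zsbrace_embed : {f : {additive R1 -> zsbrace} | injective f}.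
Proof.
pose f (r : R1) : zsbrace := asym_inr zsbrace_datum (r, 0).
have fB : zmod_morphism f.
  move=> r r'; rewrite /f -raddfB; congr (asym_inr _ (_, _)).
  by rewrite subrr.
pose fM := GRing.isZmodMorphism.Build R1 zsbrace f fB.
by exists (HB.pack_for {additive R1 -> zsbrace} f fM) => /= r r' [].
Qed.

End Construction.

(* Any multiple of #|A| would do as modulus; the factor 2 avoids 'Z_1, which
   denotes Z/2. *)
Definition trivial_ext (A : finZmodType) : Type := (A * 'Z_(#|A|.*2))%type.

(** * A commutative ring containing a given finite abelian group *)

Section TrivialExtension.
Variable A : finZmodType.
Local Notation Z := 'Z_(#|A|.*2).
Local Notation E := (trivial_ext A).
HB.instance Definition _ := FinRing.Zmodule.on E.
Implicit Types (x y z : E) (a : A) (m n : Z).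

Lemma card_double_gt1 : (1 < #|A|.*2)%N.
Proof. by rewrite -[1%N]/(0.*2.+1) ltn_Sdouble; apply/card_gt0P; exists 0. Qed.

(** Residues scale [A] consistently, since the modulus is a multiple of [#|A|], which kills [A]. *)
Lemma mulrn_modZ a k : a *+ (k %% (Zp_trunc #|A|.*2).+2) = a *+ k.
Proof.
rewrite Zp_cast ?card_double_gt1 // {2}(divn_eq k #|A|.*2) mulrnDr.
by rewrite -muln2 mulnCA mulrnA mulrn_card mul0rn add0r.
Qed.

Lemma mulrn_ZD a m n : a *+ (m + n)%R = a *+ m + a *+ n.
Proof. by rewrite mulrn_modZ mulrnDr. Qed.

Lemma mulrn_ZM a m n : a *+ (m * n)%R = a *+ m *+ n.
Proof. by rewrite mulrn_modZ mulrnA. Qed.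

(** The square-zero extension: [A] becomes an ideal in which all products vanish. *)
Definition trivial_ext_mul x y : E := (x.1 *+ y.2 + y.1 *+ x.2, x.2 * y.2).
Definition trivial_ext_one : E := (0, 1).

Fact trivial_ext_mulA : associative trivial_ext_mul.
Proof.
move=> x y z; rewrite /trivial_ext_mul /= mulrA !mulrn_ZM !mulrnDl addrA.
by rewrite -!mulrnA (mulnC x.2) (mulnC x.2).
Qed.

Fact trivial_ext_mulC : commutative trivial_ext_mul.
Proof. by move=> x y; rewrite /trivial_ext_mul addrC mulrC. Qed.

Fact trivial_ext_mul1 : left_id trivial_ext_one trivial_ext_mul.
Proof. by case=> a n; rewrite /trivial_ext_mul /= mul0rn add0r mul1r. Qed.

Fact trivial_ext_mulDl : left_distributive trivial_ext_mul +%R.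
Proof.
move=> x y z; rewrite /trivial_ext_mul /= mulrnDl mulrn_ZD mulrDl.
by rewrite addrACA.
Qed.

Fact trivial_ext_one_neq0 : trivial_ext_one != 0.
Proof. by apply/eqP=> -[/eqP]; rewrite oner_eq0. Qed.

HB.instance Definition _ := GRing.Zmodule_isComNzRing.Build E
  trivial_ext_mulA trivial_ext_mulC trivial_ext_mul1 trivial_ext_mulDl
  trivial_ext_one_neq0.
HB.saturate trivial_ext.

Lemma trivial_ext_embed : {f : {additive A -> E} | injective f}.
Proof.
pose f a : E := (a, 0).
have fB : zmod_morphism f by move=> a a'; congr (_, _); rewrite subrr.
pose fM := GRing.isZmodMorphism.Build A E f fB.
by exists (HB.pack_for {additive A -> E} f fM) => /= a a' [].
Qed.

End TrivialExtension.

Theorem theorem3p4 (A : finZmodType) :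
  exists B : finLeftBraceType,
    [/\ simple_left_brace B,
        exists (H : {set B}) (f : {additive A -> B}),
          [/\ GRing.zmod_closed H, injective f & f @: [set: A] = H],
        metabelian [set: B]
      & forall (p : nat) (P : {group B}),
          prime p -> P \in 'Syl_p([set: B])%g -> abelian P].
Proof.
pose R1 : finComNzRingType := trivial_ext A.
pose R2 : finComNzRingType := 'Z_(#|R1|.+1).
(* Consecutive integers are coprime; [#|R1|] being positive makes the modulus exceed 1, so [R2]
   really has [#|R1| + 1] elements. *)
have coR : coprime #|R1| #|R2|.
  rewrite card_ord Zp_cast ?coprimenS // ltnS.
  by apply/card_gt0P; exists 0.
exists (asym (zsbrace_datum R1 R2)); split.
- exact: zsbrace_simple.
- have [f f_inj] := trivial_ext_embed A.
  have [g g_inj] := zsbrace_embed R1 R2.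
  exists ((g \o f) @: [set: A]), (g \o f); split=> //; last exact: inj_comp.
  split=> [|_ _ /imsetP[a _ ->] /imsetP[a' _ ->]].
    by apply/imsetP; exists 0; rewrite ?raddf0.
  by apply/imsetP; exists (a - a'); rewrite ?raddfB.
- exact: asym_metabelian.
move=> p P p_pr; rewrite inE => /pHall_pgroup.
exact: zsbrace_sylow_abelian.
Qed.
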